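(* For every integer $p\ge 0$, $$\lim_{n\to\infty}\frac{1}{n}\sum_{i=0}^{n-1}\left(\frac{i}{n}\right)^{2p}=\frac{1}{2p+1}.$$
   Context: Here $n$ ranges over positive integers, and $0^0=1$ by convention (relevant only for $p=0$, $i=0$). *)

(* Defs.v *)
From mathcomp Require Import all_boot all_order all_algebra.
From mathcomp Require Import all_classical all_reals all_analysis.
Set Implicit Arguments.
Unset Strict Implicit.
Unset Printing Implicit Defensive.

(* Main.v *)
Require Import Defs.
From mathcomp Require Import all_boot all_order all_algebra.
From mathcomp Require Import all_classical all_reals all_analysis.
Import Order.TTheory GRing.Theory Num.Theory.
Import numFieldNormedType.Exports.
Local Open Scope classical_set_scope.
Local Open Scope ring_scope.

(** The quantity is the left Riemann sum of [x ^ k] on [[0, 1]], with [k = 2p].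
    For [0 <= y <= x], factoring [x ^ (k + 1) - y ^ (k + 1)] bounds it below by
    [(k + 1) y ^ k (x - y)] and above by [(k + 1) x ^ k (x - y)].  Applied to
    consecutive points [y = i / n] and [x = (i + 1) / n] and summed over [i],
    the middle terms telescope to [1], so [1 / (k + 1)] lies between the left
    and the right Riemann sums.  These two sums differ by at most [1 / n], which
    gives the bounds [left_riemann_sumX_le] and [left_riemann_sumX_ge], and the
    limit follows by squeezing.  The parity of the exponent plays no role. *)

Lemma subrXX_ge {R : numDomainType} (k : nat) (x y : R) : 0 <= y -> y <= x ->
  k.+1%:R * (y ^+ k * (x - y)) <= x ^+ k.+1 - y ^+ k.+1.
Proof.
move=> y0 yx; rewrite subrXX mulrA [leRHS]mulrC ler_wpM2r ?subr_ge0//.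
rewrite -[X in X%:R * _]card_ord mulr_natl -sumr_const ler_sum// => i _.
have ik : (i <= k)%N by rewrite -ltnS.
rewrite -[in leLHS](subnK ik) exprD ler_wpM2r ?exprn_ge0//.
by rewrite lerXn2r ?nnegrE// (le_trans y0).
Qed.

Lemma subrXX_le {R : numDomainType} (k : nat) (x y : R) : 0 <= y -> y <= x ->
  x ^+ k.+1 - y ^+ k.+1 <= k.+1%:R * (x ^+ k * (x - y)).
Proof.
move=> y0 yx; have x0 := le_trans y0 yx.
rewrite subrXX mulrA [leLHS]mulrC ler_wpM2r ?subr_ge0//.
rewrite -[X in X%:R * _]card_ord mulr_natl -sumr_const ler_sum// => i _.
have ik : (i <= k)%N by rewrite -ltnS.
rewrite -[in leRHS](subnK ik) exprD ler_wpM2l ?exprn_ge0//.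
by rewrite lerXn2r ?nnegrE.
Qed.

Lemma sub_consecutive_nodes {R : numFieldType} (n i : nat) :
  i.+1%:R / n%:R - i%:R / n%:R = n%:R^-1 :> R.
Proof. by rewrite -mulrBl -natrB// subSnn mul1r. Qed.

Lemma le_consecutive_nodes {R : numFieldType} (n i : nat) :
  i%:R / n%:R <= i.+1%:R / n%:R :> R.
Proof. by rewrite ler_wpM2r ?invr_ge0// ler_nat. Qed.

Lemma telescope_nodesX {R : numFieldType} (k n : nat) : (0 < n)%N ->
  \sum_(0 <= i < n) ((i.+1%:R / n%:R) ^+ k.+1 - (i%:R / n%:R) ^+ k.+1) = 1 :> R.
Proof.
move=> n0; rewrite (telescope_sumr (fun i => (i%:R / n%:R : R) ^+ k.+1))//.
by rewrite divff ?pnatr_eq0 -?lt0n// mul0r expr0n expr1n subr0.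
Qed.

Lemma left_riemann_sumX_le {R : numFieldType} (k n : nat) : (0 < n)%N ->
  n%:R^-1 * \sum_(0 <= i < n) (i%:R / n%:R) ^+ k <= k.+1%:R^-1 :> R.
Proof.
move=> n0; rewrite -[leRHS]mul1r ler_pdivlMr ?ltr0n//.
rewrite -[leRHS](telescope_nodesX k n n0).
rewrite mulr_sumr mulr_suml ler_sum// => i _.
have := subrXX_ge k _ _ (divr_ge0 (ler0n R i) (ler0n R n))
  (le_consecutive_nodes n i).
by rewrite sub_consecutive_nodes [k.+1%:R * _]mulrC [_ ^+ k * _]mulrC.
Qed.

Lemma left_riemann_sumX_ge {R : numFieldType} (k n : nat) : (0 < n)%N ->
  k.+1%:R^-1 - n%:R^-1 <= n%:R^-1 * \sum_(0 <= i < n) (i%:R / n%:R) ^+ k :> R.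
Proof.
move=> n0; rewrite lerBlDr.
(* Shifting the index turns the left sum into the right one; the term gained is
   [1], and the term dropped, [0 ^+ k], is nonnegative. *)
have shift : \sum_(0 <= i < n) (i.+1%:R / n%:R) ^+ k
    <= \sum_(0 <= i < n) (i%:R / n%:R) ^+ k + 1 :> R.
  have -> : \sum_(0 <= i < n) (i%:R / n%:R) ^+ k + 1
      = \sum_(0 <= i < n.+1) (i%:R / n%:R) ^+ k :> R.
    by rewrite big_nat_recr//= divff ?expr1n// pnatr_eq0 -lt0n.
  by rewrite big_nat_recl// lerDr exprn_ge0// divr_ge0.
apply: (@le_trans _ _
  (n%:R^-1 * \sum_(0 <= i < n) (i.+1%:R / n%:R) ^+ k)); last first.
  by rewrite -[X in _ + X]mulr1 -mulrDr ler_wpM2l ?invr_ge0.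
rewrite -[leLHS]mul1r ler_pdivrMr ?ltr0n// -[leLHS](telescope_nodesX k n n0).
rewrite mulr_sumr mulr_suml ler_sum// => i _.
have := subrXX_le k _ _ (divr_ge0 (ler0n R i) (ler0n R n))
  (le_consecutive_nodes n i).
by rewrite sub_consecutive_nodes [k.+1%:R * _]mulrC [_ ^+ k * _]mulrC.
Qed.

Lemma cvg_left_riemann_sumX {R : realType} (k : nat) :
  (fun n : nat => n%:R^-1 * \sum_(0 <= i < n) (i%:R / n%:R) ^+ k : R)
    @ \oo --> (k.+1%:R^-1 : R).
Proof.
apply: (@squeeze_cvgr _ _ _ _ (fun n : nat => k.+1%:R^-1 - n%:R^-1 : R)
  (fun=> k.+1%:R^-1)); last exact: cvg_cst.
  near=> n.
  have n0 : (0 < n)%N by near: n; exists 1%N.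
  by rewrite left_riemann_sumX_ge ?left_riemann_sumX_le.
rewrite -[X in _ --> X]subr0; apply: cvgB; first exact: cvg_cst.
by rewrite -cvg_shiftS; exact: cvg_harmonic.
Unshelve. all: by end_near. Qed.

Theorem lemma3 (R : realType) (p : nat) :
  (fun n : nat => n%:R^-1 * \sum_(0 <= i < n) (i%:R / n%:R) ^+ (2 * p) : R)
    @ \oo --> ((2 * p + 1)%:R^-1 : R).
Proof. by rewrite addn1; exact: cvg_left_riemann_sumX. Qed.
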